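(* Let $\mathcal B\subseteq\mathbb N$ be infinite. If $\mathcal B$ has light tails, then $X_\eta=X_\varphi$.
   Context: $\mathbb N=\{1,2,\dots\}$. For $A\subseteq\mathbb N$ let $\mathcal M_A=\bigcup_{a\in A}a\mathbb Z$. For a set $\mathcal M$ of integers, $\overline d(\mathcal M)=\limsup_{N\to\infty}\frac1N\operatorname{card}(\mathcal M\cap\{1,\dots,N\})$. $\mathcal B$ has light tails if $\lim_{K\to\infty}\overline d\big(\mathcal M_{\{b\in\mathcal B:\,b>K\}}\big)=0$. $\Delta:\mathbb Z\to\prod_{b\in\mathcal B}\mathbb Z/b\mathbb Z$, $\Delta(n)=(n \bmod b)_{b\in\mathcal B}$; $H:=\overline{\Delta(\mathbb Z)}$ (product topology); $W:=\{h\in H: h_b\neq 0\ \forall b\in\mathcal B\}$; $\varphi:H\to\{0,1\}^{\mathbb Z}$ is given by $\varphi(h)(n)=1$ iff $h+\Delta(n)\in W$. Put $\eta=\varphi(0)$ (the indicator function of $\mathbb Z\setminus\mathcal M_{\mathcal B}$), $X_\eta:=\overline{\varphi(\Delta(\mathbb Z))}$ (the orbit closure of $\eta$ under the shift) and $X_\varphi:=\overline{\varphi(H)}$, closures in the product topology on $\{0,1\}^{\mathbb Z}$. *)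

(* Defs.v *)
From HB Require Import structures.
From mathcomp Require Import all_boot all_order all_algebra.
From mathcomp Require Import all_classical all_reals all_analysis.

Set Implicit Arguments.
Unset Strict Implicit.
Unset Printing Implicit Defensive.

Import Order.TTheory GRing.Theory Num.Theory.
Import numFieldNormedType.Exports.

Local Open Scope classical_set_scope.
Local Open Scope ring_scope.

Definition multiples (A : set nat) : set int :=
  \bigcup_(a in A) range (fun k : int => a%:Z * k).

(* The value at N = 0 is 0 / 0 = 0, which does not affect the limsup. *)
Definition upper_density (R : realType) (M : set int) : \bar R :=
  limn_esup (fun N : nat =>
    ((count (fun k : nat => k%:Z \in M) (iota 1 N))%:R / N%:R)%:E).

Definition light_tails (R : realType) (B : set nat) : Prop :=
  upper_density R (multiples [set b | B b /\ (K < b)%N]) @[K --> \oo] --> 0%E.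

(* Z/bZ for b >= 1, as a discrete space: 'Z_b would be Z/2Z when b = 1, whereas
   'I_b.-1.+1 is a group of order b for every b >= 1. *)
Definition Zmod (b : nat) := discrete_topology 'I_b.-1.+1.

HB.instance Definition _ (b : nat) := DiscreteTopology.on (Zmod b).
HB.instance Definition _ (b : nat) := GRing.Zmodule.copy (Zmod b) 'I_b.-1.+1.

Definition Zmod_of_int (b : nat) (n : int) : Zmod b := inZp `|(n %% b%:Z)%Z|%N.

Section Bfree.
Variable B : set nat.

Definition residues := prod_topology (fun b : B => Zmod (val b)).

Definition Delta (n : int) : residues := fun b => Zmod_of_int (val b) n.

Definition H : set residues := closure (range Delta).

Definition W : set residues := [set h | H h /\ forall b : B, h b != 0].

Definition phi (h : residues) : {ptws int -> bool} :=
  fun n => (((fun b => h b + Delta n b) : residues) \in W).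

Definition X_eta : set {ptws int -> bool} := closure (phi @` range Delta).

Definition X_phi : set {ptws int -> bool} := closure (phi @` H).

End Bfree.

(* Main.v *)
Require Import Defs.
From mathcomp Require Import all_boot all_order all_algebra.
From mathcomp Require Import all_classical all_reals all_analysis.

Set Implicit Arguments.
Unset Strict Implicit.
Unset Printing Implicit Defensive.

(* Only the inclusion of X_phi in X_eta needs work: given h in H and a window
   0 <= n < M, one looks for an integer m with the same zeros as h there. A zero
   n of h (h_b + n = 0 for some b) is a zero of m as soon as m agrees with h
   modulo finitely many b; for the other n, no b may divide m + n.
   Fix a modulus D divisible by high powers of all small primes, take z agreeing
   with h modulo all b up to a large bound, and look for m = z + D t. Put
   g_n = gcd (z + n, D) and m + n = g_n y_n(t). Prime by prime, some class of t
   makes all y_n(t) prime to R = K2!, with K2 as large as wanted; restrict t to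
   this class modulo R. If b | m + n, then b / gcd (b, g_n) divides y_n and is
   not 1, because z agrees with h modulo the divisors of D in B; hence it is
   greater than K2, and so is b.
   The elements b <= K3 of this kind only involve moduli prime to R, hence their
   multiples have the same density in the progression as in the integers, at
   most D times the density of the multiples of {b in B : b > K2}: this is small
   because K2 is chosen after D. Finally K3 is chosen after R, so that the
   elements b > K3 are negligible even inside the progression. *)

(** * Counting in initial segments *)

Definition counting (P : pred nat) (N : nat) : nat := count P (iota 0 N).

Lemma counting_sum P N : counting P N = \sum_(i < N) P i.
Proof.
rewrite /counting -sum1_count big_mkcond -[N in iota 0 N]subn0 big_mkord.
by apply: eq_bigr => i _; case: (P i).
Qed.

Lemma leq_counting (P Q : pred nat) N :
  (forall x, x < N -> P x -> Q x) -> counting P N <= counting Q N.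
Proof.
move=> PQ; rewrite !counting_sum leq_sum // => i _.
by have := PQ i (ltn_ord i); case: (P i) => // ->.
Qed.

Lemma counting_true (P : pred nat) N : (forall x, x < N -> P x) -> counting P N = N.
Proof.
move=> PT; rewrite counting_sum (eq_bigr (fun=> 1)) ?sum1_card ?card_ord //.
by move=> i _; rewrite PT.
Qed.

Lemma counting_union (M : nat) (P : nat -> pred nat) (Q : pred nat) N :
    (forall x, x < N -> Q x -> exists2 n, n < M & P n x) ->
  counting Q N <= \sum_(n < M) counting (P n) N.
Proof.
move=> QP; under eq_bigr do rewrite counting_sum.
rewrite counting_sum exchange_big leq_sum // => i _.
case Qi: (Q i) => //; have [n nM Pni] := QP i (ltn_ord i) Qi.
by rewrite (bigD1 (Ordinal nM)) //= Pni.
Qed.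

Lemma counting_incr (P Q : pred nat) (f : nat -> nat) S N :
    {homo f : x y / x < y} -> (forall s, s < S -> f s < N) ->
    (forall s, P s -> Q (f s)) ->
  counting P S <= counting Q N.
Proof.
move=> f_incr f_lt PQ; rewrite /counting -!size_filter -(size_map f).
apply: uniq_leq_size.
  rewrite map_inj_uniq ?filter_uniq ?iota_uniq // => x y fxy.
  by case: (ltngtP x y) => // /f_incr; rewrite fxy ltnn.
move=> x /mapP[s]; rewrite mem_filter mem_iota /= add0n => /andP[Ps sS] ->.
by rewrite mem_filter PQ // mem_iota add0n f_lt.
Qed.

Lemma periodicM (P : pred nat) L k x :
  (forall x, P (x + L) = P x) -> P (x + L * k) = P x.
Proof. by move=> PL; elim: k => [|k IH]; rewrite ?muln0 ?addn0 // mulnSr addnA PL. Qed.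

Lemma periodic_mod (P : pred nat) L x :
  (forall x, P (x + L) = P x) -> P (x %% L) = P x.
Proof.
by move=> PL; rewrite [in RHS](divn_eq x L) addnC mulnC periodicM.
Qed.

Lemma counting_periodic (P : pred nat) L q :
  (forall x, P (x + L) = P x) -> counting P (L * q) = q * counting P L.
Proof.
move=> PL; elim: q => [|q IH]; first by rewrite muln0.
rewrite /counting mulnSr iotaD count_cat -!/(counting _ _) IH mulSnr; congr addn.
rewrite add0n -[X in iota X]addn0 iotaDl count_map; apply: eq_count => x /=.
by rewrite addnC periodicM.
Qed.

(** Since [a] is invertible modulo [L], the map s -> c + a s permutes the residues modulo [L]. *)
Lemma counting_affine (P : pred nat) L a c :
    coprime a L -> (forall x, P (x + L) = P x) ->
  counting (fun s => P (c + a * s)) L = counting P L.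
Proof.
case: L => [//|L] aL PL; rewrite !counting_sum.
pose f (s : 'I_L.+1) := inord (n' := L) ((c + a * s) %% L.+1).
have f_inj : injective f.
  move=> s t /(congr1 val); rewrite /= !inordK ?ltn_mod // => /eqP.
  rewrite eqn_modDl => st; apply: ord_inj.
  wlog le_ts : s t st / t <= s.
    by move=> W; case: (leqP t s) => [|/ltnW] le; [|symmetry]; apply: W => //;
       rewrite eq_sym.
  move: st; rewrite eqn_mod_dvd ?leq_mul2l ?le_ts ?orbT // -mulnBr.
  rewrite Gauss_dvdr 1?coprime_sym //.
  have [/eqP|d_gt0] := posnP (s - t).
    by rewrite subn_eq0 => le_st _; apply/eqP; rewrite eqn_leq le_st.
  move=> /(dvdn_leq d_gt0); rewrite leqNgt.
  by rewrite (leq_ltn_trans (leq_subr t s)).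
rewrite [RHS](reindex_inj f_inj); apply: eq_bigr => s _ /=.
by rewrite inordK ?ltn_mod // periodic_mod.
Qed.

(** * Small primes and coprimality *)

Lemma prime_dvd_fact p k : prime p -> p %| k`! -> p <= k.
Proof.
move=> p_pr; elim: k => [|k IH]; first by rewrite Euclid_dvd1.
rewrite factS Euclid_dvdM // => /orP[/dvdn_leq->//|/IH/leqW //].
Qed.

Lemma coprime_fact k x :
  (forall p, prime p -> p <= k -> ~~ (p %| x)) -> coprime k`! x.
Proof.
move=> small; rewrite /coprime; apply: contraT => d_neq1.
have d_gt1 : 1 < gcdn k`! x by rewrite ltn_neqAle eq_sym d_neq1 gcdn_gt0 fact_gt0.
have := small _ (pdiv_prime d_gt1); rewrite (dvdn_trans (pdiv_dvd _)) ?dvdn_gcdr //.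
by apply; rewrite prime_dvd_fact ?pdiv_prime // (dvdn_trans (pdiv_dvd _)) ?dvdn_gcdl.
Qed.

(** Chinese remaindering, one prime at a time: a prime [k.+1] is coprime to
    [k]![, and a solution kept modulo]k[!] stays valid for every prime up to [k]. *)
Lemma avoid_small_primes (F : nat -> nat -> Prop) k :
    (forall p s t, prime p -> s = t %[mod p] -> F p s -> F p t) ->
    (forall p, prime p -> exists t, F p t) ->
  exists t, forall p, prime p -> p <= k -> F p t.
Proof.
move=> Fmod Fex; elim: k => [|k [T FT]]; first by exists 0; case.
have [p_pr|p_npr] := boolP (prime k.+1); last first.
  exists T => p p_pr; rewrite leq_eqVlt => /predU1P[pk|]; last exact: FT.
  by rewrite pk (negbTE p_npr) in p_pr.
have [t Ft] := Fex _ p_pr.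
have co : coprime k`! k.+1.
  rewrite coprime_sym prime_coprime //; apply/negP.
  by move=> /(prime_dvd_fact p_pr); rewrite ltnn.
exists (chinese k`! k.+1 T t) => p pp; rewrite leq_eqVlt => /predU1P[->|pk].
  by apply: (Fmod _ t) => //; rewrite chinese_modr.
apply: (Fmod _ T) => //; last exact: FT.
have pf : p %| k`! by apply: dvdn_fact; rewrite prime_gt0.
by rewrite -(modn_dvdm T pf) -(chinese_modl co T t) modn_dvdm.
Qed.

Lemma coprime_gcdn_quotients x y :
  0 < gcdn x y -> coprime (x %/ gcdn x y) (y %/ gcdn x y).
Proof.
move=> d_gt0; rewrite /coprime -(eqn_pmul2l d_gt0) muln1 muln_gcdr.
by rewrite ![gcdn x y * _]mulnC !divnK ?dvdn_gcdl ?dvdn_gcdr.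
Qed.

Lemma dvdn_gcdn_quotient b g y :
  0 < g -> b %| g * y -> b %/ gcdn b g %| y.
Proof.
move=> g_gt0; have d_gt0 : 0 < gcdn b g by rewrite gcdn_gt0 g_gt0 orbT.
rewrite -{1}(divnK (dvdn_gcdl b g)) -{3}(divnK (dvdn_gcdr b g)).
by rewrite mulnAC dvdn_pmul2r // Gauss_dvdr // coprime_gcdn_quotients.
Qed.

(** * The progression z + n + D t with its common factor removed *)

Section ReducedProgression.
Variables z D : nat.
Hypothesis D_gt0 : 0 < D.

(** [common n] and [reduced n t] are the g_n and y_n(t) of the overview. *)
Definition common n := gcdn (z + n) D.

Definition reduced n t := (z + n) %/ common n + D %/ common n * t.

Lemma common_gt0 n : 0 < common n.
Proof. by rewrite gcdn_gt0 D_gt0 orbT. Qed.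

Lemma reducedE n t : z + n + D * t = common n * reduced n t.
Proof.
rewrite mulnDr mulnA ![common n * (_ %/ _)]mulnC.
by rewrite !divnK ?dvdn_gcdl ?dvdn_gcdr.
Qed.

Lemma reduced_mod p n s t :
  s = t %[mod p] -> (p %| reduced n s) = (p %| reduced n t).
Proof.
by move=> st; rewrite /dvdn -modnDmr -modnMmr st modnMmr modnDmr.
Qed.

(* If [p] divides [D], then [p] divides [D %/ common n] except for at most one
   [n < M], since [p ^ M] exceeds the window; for that [n], [reduced n t] is
   nonzero modulo [p] for [t = 0] or [t = 1]. *)
Lemma prime_avoids_reduced M p :
    prime p -> (p %| D -> p ^ M %| D) -> (~~ (p %| D) -> M < p) ->
  exists t, forall n, n < M -> ~~ (p %| reduced n t).
Proof.
move=> p_pr pMD MpD; have [pD|pND] := boolP (p %| D).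
  have off n : p %| D %/ common n -> forall t, ~~ (p %| reduced n t).
    move=> pn t; rewrite /reduced dvdn_addl ?dvdn_mulr //; apply/negP => pq.
    have := coprime_gcdn_quotients (common_gt0 n); rewrite /coprime => /eqP co.
    have : p %| gcdn ((z + n) %/ common n) (D %/ common n) by rewrite dvdn_gcd pq.
    by rewrite co dvdn1 => /eqP p1; rewrite p1 in p_pr.
  have deep n : ~~ (p %| D %/ common n) -> p ^ M %| z + n.
    move=> pn; apply: dvdn_trans (dvdn_gcdl _ D).
    have := pMD pD; rewrite -{1}(divnK (dvdn_gcdr (z + n) D)) Gauss_dvdr //.
    by rewrite coprimeXl // prime_coprime.
  have [all_on|] := pselect (forall n, n < M -> p %| D %/ common n).
    by exists 0 => n /all_on/off.
  move=> /existsNP[n0 /not_implyP[n0M /negP n0_off]].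
  have uniq n : n < M -> n != n0 -> p %| D %/ common n.
    move=> nM nn0; apply: contraNT nn0 => /deep dn.
    have := deep _ n0_off => dn0; have := ltn_expl M (prime_gt1 p_pr) => lt.
    wlog le : n n0 {n0_off} nM n0M dn dn0 / n <= n0.
      by move=> W; case: (leqP n n0) => [|/ltnW] le; [|rewrite eq_sym]; apply: W.
    have : p ^ M %| n0 - n by rewrite -(subnDl z) dvdn_sub.
    have [/eqP|d_gt0] := posnP (n0 - n).
      by rewrite subn_eq0 eqn_leq le.
    move=> /(dvdn_leq d_gt0); rewrite leqNgt (leq_ltn_trans _ lt) //.
    by rewrite (leq_trans (leq_subr n n0)) // ltnW.
  have [t Ht] : exists t, ~~ (p %| reduced n0 t).
    have [p0|] := boolP (p %| (z + n0) %/ common n0).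
      by exists 1; rewrite /reduced muln1 dvdn_addr.
    by exists 0; rewrite /reduced muln0 addn0.
  exists t => n nM; have [->//|nn0] := eqVneq n n0.
  exact: off (uniq _ nM nn0) _.
have {}MpD := MpD pND.
have coD : coprime D p by rewrite coprime_sym prime_coprime.
(* Here [p] does not divide [D]. For this t, z + n + D t is n + 1 modulo [p], and 0 < n + 1 <= M <
   p. *)
have [t Ht] : exists t, z + D * t = 1 %[mod p].
  (* The multiple of [D * p] ensures z <= w, so that the truncated difference [w - z] is the true
     one. *)
  pose w := chinese D p z 1 + D * p * z.
  have zw : z <= w.
    rewrite (leq_trans _ (leq_addl _ _)) // leq_pmull //.
    by rewrite muln_gt0 D_gt0 prime_gt0.
  have Dw : D %| w - z.
    by rewrite -eqn_mod_dvd // /w addnC -mulnA mulnC modnMDl chinese_modl.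
  exists ((w - z) %/ D); rewrite mulnC divnK // subnKC //.
  by rewrite /w addnC mulnAC modnMDl chinese_modr.
exists t => n nM; apply/negP => pc.
have : p %| common n * reduced n t by rewrite dvdn_mull.
rewrite -reducedE addnAC /dvdn -modnDml Ht modnDml -/(dvdn _ _).
by move/(dvdn_leq (ltn0Sn n)); rewrite leqNgt (leq_ltn_trans nM).
Qed.
End ReducedProgression.

(** * The sieve on integers *)

Definition has_divisor_above (B : nat -> Prop) (K : nat) : pred nat :=
  fun x => `[< exists b, [/\ B b, K < b & b %| x] >].

Lemma dvdn_fact_leq m n : m <= n -> m`! %| n`!.
Proof. by move=> mn; rewrite -(bin_fact mn) mulnCA dvdn_mulr. Qed.

Lemma avoid_multiples (B : nat -> Prop) (M K0 : nat) (A : pred nat)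
    (G : nat -> Prop) :
    0 < M -> (forall b, B b -> 0 < b) ->
    (forall e, 0 < e -> exists K N0, forall N, N0 <= N ->
       e * counting (has_divisor_above B K) N <= N) ->
    (forall K, exists2 z, G z & forall n b,
       n < M -> A n -> B b -> b <= K -> ~~ (b %| z + n)) ->
  exists z m, [/\ G z, m = z %[mod K0`!] &
    forall n b, n < M -> A n -> B b -> ~~ (b %| m + n)].
Proof.
move=> M_gt0 B_gt0 light approx.
pose P := maxn K0 M; pose D := P`! ^ M.+1.
have D_gt0 : 0 < D by rewrite expn_gt0 fact_gt0.
have K0D : K0`! %| D by rewrite /D expnS dvdn_mulr // dvdn_fact_leq // leq_maxl.
(* There will be 2M bad sets of s < S, each allowed S / (4M) elements, so that half of the s remain.
   The factor [D] pays for counting below D S instead of S. *)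
have [|K1 [N1 light1]] := light (4 * M * D); first by rewrite !muln_gt0 M_gt0.
pose K2 := maxn K1 D; pose R := K2`!.
have R_gt0 : 0 < R by exact: fact_gt0.
have DR : D %| R by rewrite dvdn_fact // D_gt0 leq_maxr.
have [z Gz zD] := approx D; exists z.
have [T HT] : exists T, forall p, prime p -> p <= K2 ->
    forall n, n < M -> ~~ (p %| reduced z D n T).
  apply: (@avoid_small_primes (fun p t => forall n, n < M -> ~~ (p %| reduced z D n t))).
    by move=> p s t _ st H n /H; rewrite (reduced_mod _ _ _ st).
  move=> p p_pr; apply: prime_avoids_reduced => //.
    rewrite Euclid_dvdX // => /andP[pP _].
    by rewrite (dvdn_trans (dvdn_exp2r M pP)) // dvdn_exp2l.
  move=> pD; rewrite ltnNge; apply: contra pD => pM.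
  rewrite Euclid_dvdX // dvdn_fact // prime_gt0 //=.
  by rewrite (leq_trans pM) ?leq_maxr.
(* The factor 2 D R pays for the values m(s) + n, which for s < S stay below 2 D R S. *)
have [|K3 [N3 light3]] := light (2 * (D * R) * (4 * M)).
  by rewrite !muln_gt0 M_gt0 D_gt0 R_gt0.
pose g n := gcdn (z + n) D; pose a n := D %/ g n * R.
pose c n := reduced z D n T; pose m s := z + D * (T + R * s).
have mE n s : m s + n = g n * (c n + a n * s).
  rewrite /m addnAC reducedE //; congr muln.
  by rewrite /c /a /reduced mulnDr addnA mulnA.
have g_gt0 n : 0 < g n by exact: common_gt0.
have co n s : n < M -> coprime R (c n + a n * s).
  move=> nM; apply: coprime_fact => p p_pr pK.
  have pR : p %| R by rewrite dvdn_fact // prime_gt0.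
  by rewrite dvdn_addl ?HT // dvdn_mulr // dvdn_mull.
pose L := K3`!`_(\pi(R)^').
have L_gt0 : 0 < L by exact: part_gt0.
have RL : coprime R L by rewrite (pnat_coprime (pnat_pi R_gt0)) // part_pnat.
(* [S] has to be a multiple of the period [L], and to dominate both thresholds and the offset z + D
   T + M. *)
pose q := N1 + N3 + z + D * T + M.
have q_gt0 : 0 < q by rewrite /q addn_gt0 M_gt0 orbT.
pose S := L * q.
have qS : q <= S by rewrite leq_pmull.
pose Gamma n : pred nat := fun x => `[< exists b,
  [/\ B b, K2 < b, b %/ gcdn b (g n) %| L & b %/ gcdn b (g n) %| x] >].
have GammaL : forall n x, Gamma n (x + L) = Gamma n x.
  move=> n x; apply: asbool_equiv_eq; split=> -[b [Bb Kb bL bx]]; exists b; split=> //.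
    by rewrite -(dvdn_addl _ bL).
  by rewrite dvdn_addl.
pose bad1 n s := Gamma n (c n + a n * s).
pose bad2 n s := has_divisor_above B K3 (m s + n).
(* [S] is a whole number of periods and [a n] is prime to [L], so the progression can be replaced by
   all x < S; multiplication by [g n] then turns a multiple of the quotient of b into a multiple of
   b. *)
have bad1_le n : 4 * M * counting (bad1 n) S <= S.
  have aL : coprime (a n) L.
    apply: (@coprime_dvdl _ (R * R)); last by rewrite coprimeMl RL.
    by rewrite dvdn_mul // (dvdn_trans _ DR) // dvdn_div // dvdn_gcdr.
  rewrite /S counting_periodic; last first.
    by move=> s; rewrite /bad1 mulnDr addnA [a n * L]mulnC periodicM.
  rewrite counting_affine // -counting_periodic // -/S.
  have : counting (Gamma n) S <= counting (has_divisor_above B K2) (D * S).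
    apply: (@counting_incr _ _ (muln (g n))).
    - by move=> x y xy; rewrite ltn_pmul2l.
    - move=> s sS; apply: leq_ltn_trans (_ : D * s < _); last by rewrite ltn_pmul2l.
      by rewrite leq_mul2r dvdn_leq ?orbT // dvdn_gcdr.
    - move=> s /asboolP[b [Bb Kb _ bs]]; apply/asboolP; exists b; split=> //.
      by rewrite -(divnK (dvdn_gcdl b (g n))) mulnC dvdn_mul // dvdn_gcdr.
  have : counting (has_divisor_above B K2) (D * S) <=
      counting (has_divisor_above B K1) (D * S).
    apply: leq_counting => x _ /asboolP[b [Bb Kb bx]]; apply/asboolP; exists b.
    by split=> //; apply: leq_ltn_trans Kb; rewrite leq_maxl.
  move=> le1 le2; rewrite -(leq_pmul2l D_gt0); apply: leq_trans (light1 _ _).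
    by rewrite mulnA [D * _]mulnC leq_mul2l (leq_trans le2 le1) orbT.
  apply: leq_trans (leq_trans qS (leq_pmull _ D_gt0)).
  by rewrite /q -!addnA leq_addr.
have bad2_le n : n < M -> 4 * M * counting (bad2 n) S <= S.
  move=> nM.
  have : counting (bad2 n) S <= counting (has_divisor_above B K3) (m S + M).
    apply: (@counting_incr _ _ (fun s => m s + n)) => //.
      by move=> x y xy; rewrite ltn_add2r ltn_add2l ltn_pmul2l // ltn_add2l ltn_pmul2l.
    move=> s sS; rewrite -addnS leq_add // leq_add2l leq_mul2l leq_add2l.
    by rewrite leq_mul2l (ltnW sS) !orbT.
  move=> le; have DR_gt0 : 0 < D * R by rewrite muln_gt0 D_gt0.
  have mS : m S + M <= 2 * (D * R) * S.
    rewrite mul2n -addnn mulnDl /m mulnDr mulnA addnA addnAC leq_add2r.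
    rewrite (leq_trans _ (leq_pmull _ DR_gt0)) // (leq_trans _ qS) // /q.
    by rewrite !leq_add2r leq_addl.
  rewrite -(@leq_pmul2l (2 * (D * R))); last by rewrite muln_gt0.
  apply: leq_trans mS; apply: leq_trans (light3 _ _).
    by rewrite mulnA leq_mul2l le orbT.
  apply: (@leq_trans q); first by rewrite /q -!addnA addnCA leq_addr.
  apply: leq_trans (leq_addr _ _); apply: leq_trans (leq_addl _ _).
  rewrite (leq_trans qS) // mulnDr mulnA (leq_trans _ (leq_addl _ _)) //.
  exact: leq_pmull.
suff [s Hs] : exists s, forall n b, n < M -> A n -> B b -> ~~ (b %| m s + n).
  exists (m s); split=> //; rewrite /m addnC.
  by rewrite -modnDml -modnMml (eqP K0D) mul0n mod0n.
apply: contrapT => /forallNP none.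
have all_bad s : s < S -> exists2 n, n < M & predU (bad1 n) (bad2 n) s.
  move=> _; apply: contrapT => ok; apply: (none s) => n b nM An Bb.
  apply/negP => bmn; apply: ok; exists n => //=.
  have [bK3|K3b] := leqP b K3; last by apply/orP; right; apply/asboolP; exists b.
  apply/orP; left; apply/asboolP; exists b.
  pose b' := b %/ gcdn b (g n); rewrite -/b'.
  have b'y : b' %| c n + a n * s by rewrite dvdn_gcdn_quotient // -mE.
  have Rb' : coprime R b' by rewrite (coprime_dvdr b'y) // co.
  have b'1 : b' != 1.
    apply: contraTneq An => b'1; apply/negP => An.
    have bg : b %| g n.
      by rewrite -(divnK (dvdn_gcdl b (g n))) -/b' b'1 mul1n dvdn_gcdr.
    have bD : b <= D by rewrite dvdn_leq // (dvdn_trans bg) // dvdn_gcdr.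
    by have := zD n b nM An Bb bD; rewrite (dvdn_trans bg) // dvdn_gcdl.
  have b_gt0 := B_gt0 b Bb.
  have b'_gt0 : 0 < b'.
    by rewrite divn_gt0 ?gcdn_gt0 ?b_gt0 // dvdn_leq // dvdn_gcdl.
  have K2b' : K2 < b'.
    rewrite ltnNge; apply: contra b'1 => b'K2.
    move: Rb'; rewrite coprime_sym /coprime => /eqP <-.
    by rewrite eq_sym -[_ == _]/(_ == _); apply/eqP/gcdn_idPl/dvdn_fact/andP.
  split=> //; first exact: leq_trans K2b' (leq_div _ _).
  rewrite -(@part_pnat_id \pi(R)^' b') ?partn_dvd ?fact_gt0 //.
    by rewrite (@dvdn_trans b) ?dvdn_div ?dvdn_fact ?b_gt0 ?dvdn_gcdl.
  by rewrite -coprime_pi'.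
have : S <= \sum_(n < M) counting (predU (bad1 n) (bad2 n)) S.
  rewrite -{1}(@counting_true predT S) //.
  by apply: (@counting_union M (fun n => predU (bad1 n) (bad2 n)))
    => s sS _; exact: all_bad.
apply/negP; rewrite -ltnNge -(@ltn_pmul2l (4 * M)) ?muln_gt0 //.
rewrite big_distrr /=; apply: leq_ltn_trans (_ : \sum_(n < M) 2 * S < _).
  apply: leq_sum => n _; rewrite mul2n -addnn.
  apply: leq_trans (leq_add (bad1_le n) (bad2_le n (ltn_ord n))).
  by rewrite -mulnDr leq_mul2l /counting -count_predUI leq_addr orbT.
rewrite sum_nat_const card_ord.
have : 0 < M * S by rewrite muln_gt0 M_gt0 (leq_trans q_gt0).
by move=> MS; rewrite mulnCA -mulnA ltn_pmul2r.
Qed.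

Import Order.TTheory GRing.Theory Num.Theory.
Import numFieldNormedType.Exports.
Local Open Scope classical_set_scope.

(** * Products of discrete spaces and residues *)

Lemma cvg_prod_eventually (I : Type) (T : I -> topologicalType)
    (u : nat -> prod_topology T) (l : prod_topology T) :
  (forall i, \forall k \near \oo, u k i = l i) -> u @ \oo --> l.
Proof.
move=> ul; apply/cvg_sup => i A [_ [[U oU <-] Ul] UA].
rewrite nbhs_filterE; apply: filterS (ul i) => k uk; apply: UA.
by rewrite /= uk.
Qed.

Lemma near_prod_discrete (I : eqType) (T : I -> discreteTopologicalType)
    (h : prod_topology T) i :
  \forall x \near h, x i = h i.
Proof. exact: (@proj_continuous I (fun i => T i) i h _ (discrete_set1 (h i))). Qed.

Section Residues.
Local Open Scope ring_scope.
Variable b : nat.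
Hypothesis b_gt0 : (0 < b)%N.

Lemma val_Zmod_of_int (n : int) :
  (\val (Zmod_of_int b n) : nat)%:Z = (n %% b%:Z)%Z.
Proof.
have b_neq0 : b%:Z != 0 by rewrite eqz_nat -lt0n.
rewrite /= prednK // modn_small; first by rewrite gez0_abs ?modz_ge0.
by rewrite -ltz_nat gez0_abs ?modz_ge0 // ltz_pmod.
Qed.

Lemma Zmod_of_int_eq0 (n : int) : (Zmod_of_int b n == 0) = (b%:Z %| n)%Z.
Proof.
by rewrite (sameP dvdz_mod0P eqP) -val_Zmod_of_int -val_eqE eqz_nat.
Qed.

Lemma Zmod_of_intD (m n : int) :
  Zmod_of_int b m + Zmod_of_int b n = Zmod_of_int b (m + n).
Proof.
have val_add (x y : Zmod b) : ((\val (x + y)%R : nat) = (val x + val y) %% b)%N.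
  by transitivity ((val x + val y) %% b.-1.+1)%N; last rewrite [X in (_ %% X)%N]prednK.
apply/val_inj/eqP; rewrite -eqz_nat val_Zmod_of_int val_add -modz_nat PoszD.
by rewrite !val_Zmod_of_int modzDm.
Qed.
End Residues.

(** * From upper density to counting bounds *)

Section LightTails.
Variable (R : realType).
Lemma light_tails_counting (B : set nat) (e : nat) :
    light_tails R B -> (0 < e)%N ->
  exists K N0, forall N, (N0 <= N)%N ->
    (e * counting (has_divisor_above B K) N <= N)%N.
Proof.
move=> light e_gt0.
(* The factor 2 leaves room for x = 0, which [counting] includes and [upper_density] does not: it
   costs at most e <= N / 2. *)
pose r : R := ((2 * e)%:R^-1)%R.
have r_gt0 : (0 < r)%R by rewrite invr_gt0 ltr0n muln_gt0.
have nb : \forall x \near (0%E : \bar R), (x < r%:E)%E.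
  by apply: open_nbhs_nbhs; split; [exact: open_ereal_lt_ereal|rewrite /= lte_fin].
have [K _ /(_ K (leqnn K))] := light _ nb.
move=> /ereal_inf_lt[_ [V [N0 _ NV] <-]] Vr.
exists K, (maxn (2 * e) N0) => N; rewrite geq_max => /andP[eN N0N].
set M := multiples _ in Vr.
have : (((count (fun k : nat => Posz k \in M) (iota 1 N))%:R / N%:R)%:E < r%:E)%E.
  by apply: le_lt_trans Vr; apply: ereal_sup_ubound; exists N => //; exact: NV.
have N_gt0 : (0 < N)%N by rewrite (leq_trans _ eN) // muln_gt0.
rewrite lte_fin ltr_pdivrMr ?ltr0n // mulrC ltr_pdivlMr ?ltr0n ?muln_gt0 //.
rewrite -natrM ltr_nat => /ltnW le.
rewrite -(leq_pmul2l (ltn0Sn 1)) mulnA [X in _ <= X]mul2n -addnn.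
apply: leq_trans (leq_add eN le); rewrite [X in _ + X]mulnC -mulnS leq_mul2l.
apply/orP; right; rewrite /counting; case: (N) N_gt0 => [//|n] _.
apply: (@leq_trans (1 + count (has_divisor_above B K) (iota 1 n))).
  by rewrite /= leq_add2r leq_b1.
rewrite add1n ltnS -[X in _ <= count _ (iota _ X)]addn1 iotaD count_cat.
rewrite (leq_trans _ (leq_addr _ _)) //.
apply: sub_count => k /asboolP[b [Bb Kb /dvdnP[j kj]]].
by apply/mem_set; exists b => //; exists (Posz j); rewrite // kj mulnC.
Qed.
End LightTails.

(** * Approximating points of [H] by integers *)

Section Window.
Local Open Scope ring_scope.
Variable B : set nat.
Hypothesis B_gt0 : forall b : nat, B b -> (0 < b)%N.

Lemma DeltaD (m n : int) (b : B) : @Delta B m b + @Delta B n b = @Delta B (m + n) b.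
Proof. by rewrite /Delta Zmod_of_intD //; apply: B_gt0; apply: set_valP. Qed.

Lemma Delta_eq0 (n : int) (b : B) : (@Delta B n b == 0) = ((val b)%:Z %| n)%Z.
Proof. by rewrite /Delta Zmod_of_int_eq0 //; apply: B_gt0; apply: set_valP. Qed.

(** Only finitely many b are at most [K], so agreeing with [h] at all of them defines a
    neighbourhood of [h], which meets the image of the integers. *)
Lemma H_approx (h : residues B) K :
  H h -> exists z : int, forall b : B, (val b <= K)%N -> @Delta B z b = h b.
Proof.
move=> Hh; have nbhs_h : Filter (nbhs h) by exact: nbhs_filter.
have nh : \forall x \near h, forall b : B, (val b <= K)%N -> x b = h b.
  elim: K => [|K IH].
    apply: (@nearW _ (nbhs h)) => x b; rewrite leqNgt => /negP[].
    by apply: B_gt0; exact: set_valP.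
  have [BK|nBK] := pselect (B K.+1).
    have bK := near_prod_discrete h (SigSub (mem_set BK)).
    apply: filterS2 IH bK => x IH bK b.
    rewrite leq_eqVlt => /predU1P[bE|]; last exact: IH.
    have -> // : b = SigSub (mem_set BK) by apply: val_inj.
  apply: filterS IH => x IH b.
  rewrite leq_eqVlt => /predU1P[bE|]; last exact: IH.
  by case: nBK; rewrite -bE; apply: set_valP.
by have [_ [[z _ <-] hz]] := Hh _ nh; exists z.
Qed.

(** The translate is a limit of the [Delta (z K + n)]. This reduces membership in [W], in the
    definition of [phi], to the nonvanishing of coordinates. *)
Lemma H_Delta (h : residues B) (n : int) :
  H h -> H ((fun b => h b + @Delta B n b) : residues B).
Proof.
move=> Hh; have /choice[z zh] := fun K => H_approx K Hh.
have : (fun K => @Delta B (z K + n)) @ \oo -->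
    ((fun b => h b + @Delta B n b) : residues B).
  apply: cvg_prod_eventually => b; exists (val b) => // K /= bK.
  by rewrite -DeltaD zh.
move=> zn; apply: (closed_cvg _ _ _ _ zn); first exact: closed_closure.
by apply: nearW => K; apply: subset_closure; exists (z K + n).
Qed.

Lemma phiP (h : residues B) (n : int) :
  H h -> phi h n <-> forall b : B, h b + @Delta B n b != 0.
Proof.
move=> Hh; rewrite /phi; split=> [/set_mem[]//|nz].
by apply/mem_set; split=> //; exact: H_Delta.
Qed.

Lemma Delta_in_H (m : int) : H (@Delta B m).
Proof. by apply: subset_closure; exists m. Qed.

(* The representative is shifted by [N] so that the window [-N, N] becomes
   [0, 2N] and the approximation a natural number. *)
Lemma H_approx_nat (h : residues B) (N K : nat) :
  H h -> exists z : nat, forall b : B, (val b <= K)%N -> @Delta B (z%:Z + N%:Z) b = h b.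
Proof.
move=> /(H_approx K)[z0 z0h].
pose w : int := z0 - N%:Z + (`|z0|%N + N)%N%:Z * K`!%:Z.
have w_ge0 : 0 <= w.
  have le : (`|z0|%N + N)%N%:Z <= (`|z0|%N + N)%N%:Z * K`!%:Z.
    by rewrite -PoszM lez_nat leq_pmulr // fact_gt0.
  apply: le_trans (lerD (lexx _) le); rewrite PoszD addrACA addNr addr0.
  by rewrite -lerBlDr sub0r abszE lerNnormlW.
exists `|w|%N => b bK; rewrite gez0_abs // -(z0h b bK).
have -> : w + N%:Z = z0 + (`|z0|%N + N)%N%:Z * K`!%:Z by rewrite /w addrAC subrK.
rewrite -DeltaD; have /eqP -> : @Delta B ((`|z0|%N + N)%N%:Z * K`!%:Z) b == 0.
  rewrite Delta_eq0 dvdz_mull // dvdzE /= dvdn_fact // bK andbT.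
  by apply: B_gt0; exact: set_valP.
by rewrite addr0.
Qed.

Lemma phi_window (R : realType) (h : residues B) (N : nat) :
    light_tails R B -> H h ->
  exists m : int, forall n : int, (`|n| <= N)%N -> phi (@Delta B m) n = phi h n.
Proof.
move=> light Hh.
pose A n := phi h (n%:Z - N%:Z); pose M := N.*2.+1.
(* Each zero of [phi h] in the window has a witness b; [K0] bounds one witness for each of these
   finitely many zeros. *)
have [K0 K0P] : exists K0, forall n, (n < M)%N -> ~~ A n ->
    exists2 b : B, (val b <= K0)%N & h b + @Delta B (n%:Z - N%:Z) b = 0.
  elim: (M) => [|k [K IH]]; first by exists 0%N.
  have [Ak|nAk] := boolP (A k).
    exists K => n; rewrite ltnS leq_eqVlt => /predU1P[->|]; last exact: IH.
    by rewrite Ak.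
  have [b hb] : exists b : B, h b + @Delta B (k%:Z - N%:Z) b = 0.
    apply: contrapT => /forallNP nz; move/negP: nAk; apply.
    by apply/phiP => // b; apply/eqP; exact: nz.
  exists (maxn K (val b)) => n; rewrite ltnS leq_eqVlt => /predU1P[->|nk] nA.
    by exists b; rewrite // leq_maxr.
  by have [c cK hc] := IH n nk nA; exists c; rewrite // leq_max cK.
have shift (z n : nat) : z%:Z + N%:Z + (n%:Z - N%:Z) = (z + n)%N%:Z.
  by rewrite addrACA subrr addr0.
pose G z := forall b : B, (val b <= K0)%N -> @Delta B (z%:Z + N%:Z) b = h b.
have [||z [m [Gz mz mA]]] := @avoid_multiples B M K0 A G isT B_gt0.
- by move=> e e_gt0; exact: (light_tails_counting light e_gt0).
- move=> K; have [z zh] := H_approx_nat N (maxn K K0) Hh; exists z.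
    by move=> b bK; apply: zh; rewrite leq_max bK orbT.
  move=> n b nM An Bb bK; apply/negP => bzn.
  have /phiP := An; move=> /(_ Hh (SigSub (mem_set Bb))).
  by rewrite -zh ?leq_max ?bK // DeltaD shift Delta_eq0 dvdzE /= bzn.
exists (m%:Z + N%:Z) => n nN.
have /andP[nl nu] : - N%:Z <= n <= N%:Z by rewrite -ler_norml -abszE lez_nat.
have nN_ge0 : 0 <= n + N%:Z by rewrite -lerBlDr sub0r.
have nM : (absz (n + N%:Z)%R < M)%N.
  by rewrite ltnS -lez_nat gez0_abs // -addnn PoszD lerD2r.
have -> : n = (absz (n + N%:Z)%R)%:Z - N%:Z by rewrite gez0_abs // addrK.
move: (absz (n + N%:Z)%R) nM => k kM.
apply/idP/idP => [/phiP|].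
  move=> /(_ (@Delta_in_H _)) mk; apply: contraT => nAk.
  have [b bK hb] := K0P k kM nAk; have := mk b.
  rewrite DeltaD shift Delta_eq0 dvdzE /=; apply: contraNT => _.
  move/eqP: hb; rewrite -Gz // DeltaD shift Delta_eq0 dvdzE /=.
  have bf : (val b %| K0`!)%N.
    by rewrite dvdn_fact // bK andbT; apply: B_gt0; exact: set_valP.
  by rewrite /dvdn -modnDml -(modn_dvdm z bf) -mz modn_dvdm // modnDml.
move=> Ak; apply/phiP => [|b]; first exact: Delta_in_H.
by rewrite DeltaD shift Delta_eq0 dvdzE /=; apply: mA => //; exact: set_valP.
Qed.
End Window.

Theorem proposition2p2 (R : realType) (B : set nat)
    (B_pos : forall b : nat, B b -> (0 < b)%N)
    (B_infinite : infinite_set B)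
    (B_light : light_tails R B) :
  X_eta B = X_phi B.
Proof.
apply/seteqP; split.
  by apply: closure_subset; apply: image_subset => _ [m _ <-]; exact: Delta_in_H.
(* Once [X_eta] is seen as its own closure, it suffices to approximate each [phi h] pointwise,
   matching it on growing windows. *)
have /closure_id -> : closed (X_eta B) by exact: closed_closure.
apply: closure_subset => _ [h Hh <-].
have /choice[m mh] := fun N => phi_window B_pos N B_light Hh.
have : (fun N => phi (@Delta B (m N))) @ \oo --> phi h.
  by apply: cvg_prod_eventually => n; exists `|n|%N => // N /=; exact: mh.
move=> mh_cvg; apply: (closed_cvg _ _ _ _ mh_cvg); first exact: closed_closure.
by apply: nearW => N; apply: subset_closure; exists (@Delta B (m N)) => //; exists (m N).
Qed.
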